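(* For $i=1,2$, let $K_i$ be a compact space, $E_i$ a Banach space and $\mathcal{H}_i$ a closed subspace of $\mathcal{C}(K_i,E_i)$. Suppose that $E_2$ does not contain an isomorphic copy of $c_0$, let $\mathcal{B}\subseteq K_2$ be a closed boundary for $\mathcal{H}_2$, and suppose that $\mathcal{H}_1$ is isomorphic to a subspace of $\mathcal{H}_2$. If $\mathcal{B}^{(k)}\cap\Omega_{\mathcal{H}_2}$ is empty for some $k\in\mathbb{N}$, then the height $ht(\mathcal{W}_{\mathcal{H}_1})$ is finite.
   Context: All topological spaces are Hausdorff; all Banach spaces are real and of dimension at least $1$ (this applies also to the subspaces $\mathcal{H}_i$). $\mathbb{N}=\{1,2,\dots\}$. For a compact space $K$ and a Banach space $E$, $\mathcal{C}(K,E)$ is the space of continuous functions $K\to E$ with the norm $\|f\|=\sup_{x\in K}\|f(x)\|$, and $\mathcal{C}(K)=\mathcal{C}(K,\mathbb{R})$. For $f\in\mathcal{C}(K)$ and $e\in E$, $f\otimes e\in\mathcal{C}(K,E)$ is $x\mapsto f(x)e$. For $e^*\in E^*$ and $h\in \mathcal{C}(K,E)$, $e^*(h)\in\mathcal{C}(K)$ is $x\mapsto\langle e^*,h(x)\rangle$. Let $\mathcal{H}\subseteq\mathcal{C}(K,E)$ be a closed subspace. - The canonical scalar function space of $\mathcal{H}$ is $\mathcal{A}=$ the closed linear span of $\{e^*(h): e^*\in E^*,\ h\in\mathcal{H}\}$ in $\mathcal{C}(K)$, and $\mathcal{A}^E=\{h\in\mathcal{A}: h\otimes e\in\mathcal{H}\text{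 for every } e\in E\}$. - The Choquet boundary $\operatorname{Ch}_{\mathcal{H}}K$ is the set of all $x\in K$ such that the evaluation functional $h\mapsto h(x)$, $h\in\mathcal{A}$, is an extreme point of the unit ball $B_{\mathcal{A}^*}$. - A point $x\in K$ is a weak peak point (with respect to $\mathcal{H}$) if for each neighbourhood $U$ of $x$ and each $\varepsilon\in(0,1)$ there is $h\in\mathcal{A}^E$ with $0\le h\le1$, $h(x)>1-\varepsilon$ and $h<\varepsilon$ on $\operatorname{Ch}_{\mathcal{H}}K\setminus U$. $\mathcal{W}_{\mathcal{H}}$ is the set of all weak peak points of $K$ with respect to $\mathcal{H}$. - $\Omega_{\mathcal{H}}=\{y\in K:\ g(y)\ne0\text{ for some }g\in\mathcal{H}\}$. - A set $\mathcal{B}\subseteq K$ is a boundary for $\mathcal{H}$ if $\|h\|=\sup_{x\in\mathcal{B}}\|h(x)\|$ for each $h\in\mathcal{H}$; it is a closed boundary if in addition it is closed in $K$. For a topological space $S$ (subsets carry the subspace topology), $S^{(0)}=S$, $S^{(1)}$ is the set of accumulation points of $S$ in $S$, $S^{(\beta+1)}=(S^{(\beta)})^{(1)}$, and $S^{(\alpha)}=\bigcap_{\beta<\alpha}S^{(\beta)}$ for limit ordinals $\alpha$. $S$ is scattered if $S^{(\alpha)}=\emptyset$ for some ordinal $\alpha$, and the least such $\alpha$ is the height $ht(S)$. Thus ''$ht(S)$ is finite'' means that $S^{(l)}=\emptyset$ for some finite $l$. *)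

(* Defs.v *)
From HB Require Import structures.
From mathcomp Require Import all_boot all_order all_algebra.
From mathcomp Require Import all_classical all_reals all_analysis.

Set Implicit Arguments.
Unset Strict Implicit.
Unset Printing Implicit Defensive.

Import Order.TTheory GRing.Theory Num.Theory.
Import numFieldNormedType.Exports.

Local Open Scope classical_set_scope.
Local Open Scope ring_scope.

(* The bounded continuous functions [K -> E] with the supremum norm.  When [K]
   is compact every continuous function is bounded ([compact_bounded_fun]), so
   this is the Banach space C(K, E). *)
Section BCFun.
Context {R : realType} (K : topologicalType) (E : normedModType R).

Definition bcont : {pred K -> E} :=
  mem [set f : K -> E | continuous f /\ bounded_fun f].

Record bcfun := BCFun { bcfun_val :> K -> E ; bcfun_valP : bcfun_val \in bcont }.

HB.instance Definition _ := [isSub for bcfun_val].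
HB.instance Definition _ := [Choice of bcfun by <:].

Lemma bounded_funE (f : K -> E) :
  bounded_fun f <-> exists M : R, forall x, `|f x| <= M.
Proof.
split=> [[M [_ HM]]|[M HM]].
  by exists (M + 1) => x; apply: HM => //; rewrite ltrDl.
exists M; split; first exact: num_real.
by move=> N MN x _ /=; exact: le_trans (HM x) (ltW MN).
Qed.

Lemma bcont_submod_closed : submod_closed bcont.
Proof.
split; first rewrite inE; first split.
- exact: cst_continuous.
- by apply/bounded_funE; exists 0 => x; rewrite normr0.
move=> a f g; rewrite !inE => -[cf bf] [cg bg]; split.
- move=> x; apply: cvgD; last exact: cg.
  by apply: cvgZl_tmp; exact: cf.
- move/bounded_funE: bf => [M HM]; move/bounded_funE: bg => [N HN].
  apply/bounded_funE; exists (`|a| * M + N) => x.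
  rewrite (le_trans (ler_normD _ _))// lerD// normrZ.
  by rewrite ler_wpM2l.
Qed.

HB.instance Definition _ :=
  GRing.isSubmodClosed.Build _ _ bcont bcont_submod_closed.
HB.instance Definition _ := [SubChoice_isSubLmodule of bcfun by <:].

Definition supnorm (f : bcfun) : R := sup (range (fun x => `|f x|)).

Lemma supnorm_ub (f : bcfun) x : `|f x| <= supnorm f.
Proof.
have := bcfun_valP f; rewrite inE => -[_ /bounded_funE [M HM]].
apply: ub_le_sup; last by exists x.
by exists M => _ [y _ <-].
Qed.

Lemma supnorm_le (f : bcfun) (M : R) :
  0 <= M -> (forall x, `|f x| <= M) -> supnorm f <= M.
Proof.
move=> M0 HM; rewrite /supnorm.
have [->|/set0P ne] := eqVneq (range (fun x => `|f x|)) set0.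
  by rewrite sup0.
by apply: ge_sup => // _ [y _ <-].
Qed.

Lemma supnorm_ge0 (f : bcfun) : 0 <= supnorm f.
Proof.
rewrite /supnorm.
have [->|/set0P[_ [x _ _]]] := eqVneq (range (fun x => `|f x|)) set0.
  by rewrite sup0.
exact: le_trans (supnorm_ub f x).
Qed.

Lemma supnormD f g : supnorm (f + g) <= supnorm f + supnorm g.
Proof.
apply: supnorm_le => [|x]; first by rewrite addr_ge0 ?supnorm_ge0.
by rewrite (le_trans (ler_normD _ _))// lerD ?supnorm_ub.
Qed.

Lemma supnormZ (a : R) f : supnorm (a *: f) = `|a| * supnorm f.
Proof.
have le (b : R) g : supnorm (b *: g) <= `|b| * supnorm g.
  apply: supnorm_le => [|x]; first by rewrite mulr_ge0 ?supnorm_ge0.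
  by rewrite /= normrZ ler_wpM2l ?supnorm_ub.
apply/le_anti; rewrite le /=.
have [->|a0] := eqVneq a 0; first by rewrite normr0 mul0r supnorm_ge0.
have := le a^-1 (a *: f); rewrite scalerA mulVf// scale1r normfV => h.
by rewrite -ler_pdivlMl// normr_gt0.
Qed.

Lemma supnorm_eq0 f : supnorm f = 0 -> f = 0.
Proof.
move=> f0; apply/val_inj/funext => x /=.
by apply/eqP; rewrite -normr_le0 -f0 supnorm_ub.
Qed.

HB.instance Definition _ :=
  Lmodule_isNormed.Build R bcfun supnormD supnormZ supnorm_eq0.

Lemma bcfun_normE (f : bcfun) : `|f| = sup (range (fun x => `|f x|)).
Proof. by []. Qed.

Lemma compact_bounded_fun (f : K -> E) :
  compact [set: K] -> continuous f -> bounded_fun f.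
Proof.
move=> cK cf; have := continuous_compact (continuous_subspaceT cf) cK.
move=> /compact_bounded [M [_ HM]]; apply/bounded_funE; exists (M + 1) => x.
by apply: (HM (M + 1)); [rewrite ltrDl | exists x].
Qed.

End BCFun.
Arguments bcont {R} K E.

Section Tensor.
Context {R : realType} {K : topologicalType} {E : normedModType R}.

Lemma tensor_subproof (f : bcfun K R^o) (e : E) :
  (fun x => f x *: e) \in bcont K E.
Proof.
have := bcfun_valP f; rewrite !inE => -[cf /bounded_funE [M HM]]; split.
- by move=> x; apply: cvgZr_tmp; exact: cf.
- by apply/bounded_funE; exists (M * `|e|) => x; rewrite normrZ ler_wpM2r.
Qed.

Definition tensor (f : bcfun K R^o) (e : E) : bcfun K E :=
  BCFun (tensor_subproof f e).

End Tensor.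

Section LinearNotions.
Context {R : realType}.

Definition closed_subspace (V : normedModType R) (H : set V) :=
  submod_closed (mem H) /\ closed H.

Definition lin_span (V : lmodType R) (G : set V) : set V :=
  [set v | exists (n : nat) (a : 'I_n -> R) (g : 'I_n -> V),
    (forall i, G (g i)) /\ v = \sum_(i < n) a i *: g i].

Definition extreme_point (V : lmodType R) (C : set V) (x : V) :=
  C x /\ forall (y z : V) (t : R), C y -> C z -> 0 < t < 1 ->
    x = t *: y + (1 - t) *: z -> y = x /\ z = x.

(* The closed unit ball of the dual of the subspace [A] of [V].  Functionals
   live on the subtype [set_type A], which has no module structure of its own;
   the first clause is linearity. *)
Definition dual_ball (V : normedModType R) (A : set V) :
    set (A -> R^o) :=
  [set phi | (forall (k : R) (a b c : A),
                set_val c = k *: set_val a + set_val b ->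
                phi c = k *: phi a + phi b) /\
             (forall a : A, `|phi a| <= `|set_val a|)].

(* [S] and [S'] are linear subspaces of [V] and [W]; [T] and [T'] only matter
   on [S] and [S']. *)
Definition isomorphic (V W : normedModType R) (S : set V) (S' : set W) :=
  exists (T : V -> W) (T' : W -> V),
    [/\ forall (k : R) u v, S u -> S v -> T (k *: u + v) = k *: T u + T v,
        set_fun S S' T /\ set_fun S' S T',
        {in S, cancel T T'} /\ {in S', cancel T' T},
        {within S, continuous T} &
        {within S', continuous T'}].

Definition isomorphic_to_subspace (V W : normedModType R)
    (S : set V) (S' : set W) :=
  exists L : set W, [/\ submod_closed (mem L), L `<=` S' & isomorphic S L].

(* [nat] carries the discrete topology, so [bcfun nat R^o] is l_infty. *)
Definition c0 : set (bcfun nat R^o) :=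
  [set u | (u : nat -> R^o) @ \oo --> (0 : R^o)].

Definition contains_c0 (E : normedModType R) :=
  isomorphic_to_subspace c0 [set: E].

End LinearNotions.
Arguments dual_ball {R V} A.
Arguments c0 {R}.

Section FunctionSpaces.
Context {R : realType} {K : topologicalType} {E : normedModType R}.
Context (H : set (bcfun K E)).

Definition canonical_scalar_space : set (bcfun K R^o) :=
  closure (lin_span
    [set g : bcfun K R^o | exists e' : {linear E -> R^o}, continuous e' /\
       exists2 h, H h & forall x, g x = e' (h x)]).

Definition tensor_multipliers : set (bcfun K R^o) :=
  [set h | canonical_scalar_space h /\ forall e : E, H (tensor h e)].

Definition evaluation (x : K) : set_type canonical_scalar_space -> R^o :=
  fun h => set_val h x.

Definition choquet_boundary : set K :=
  [set x | extreme_point (dual_ball canonical_scalar_space) (evaluation x)].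

Definition weak_peak_points : set K :=
  [set x | forall (U : set K) (eps : R), nbhs x U -> 0 < eps < 1 ->
     exists h : bcfun K R^o,
       [/\ tensor_multipliers h, forall y, 0 <= (h y : R) <= 1,
           1 - eps < h x &
           forall y, choquet_boundary y -> ~ U y -> (h y : R) < eps]].

Definition Omega : set K := [set y | exists2 g, H g & g y != 0].

Definition is_boundary (B : set K) :=
  forall h, H h -> `|h| = sup [set `|h x| | x in B].

Definition closed_boundary (B : set K) := closed B /\ is_boundary B.

End FunctionSpaces.

Section CantorBendixson.
Context {X : topologicalType}.

Definition cb_derivative (S : set X) : set X := S `&` limit_point S.

Definition cb_deriv (n : nat) (S : set X) : set X := iter n cb_derivative S.

(* Only the derivatives of finite order matter for the height to be finite. *)
Definition finite_height (S : set X) := exists l : nat, cb_deriv l S = set0.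

End CantorBendixson.

(* Main.v *)
Require Import Defs.
From HB Require Import structures.
From mathcomp Require Import all_boot all_order all_algebra.
From mathcomp Require Import all_classical all_reals all_analysis.
From mathcomp Require Import ring lra.

(* Suppose T : H1 -> H2 is an embedding and W, the set of weak peak points of H1,
   has infinite height.  Descending through the derivatives of W, choose weak
   peak functions h_1, ..., h_l with a common point where all of them exceed
   1/2, so that f = sum_s h_s (x) e has norm at least l |e| / 2.  At each step
   there is a sequence of candidates peaking on disjoint neighbourhoods; its
   signed sums are bounded on the Choquet boundary, which norms the canonical
   scalar space, so the images under T are weakly unconditionally Cauchy at each
   point and hence tend to 0 pointwise because E2 contains no c_0.  One may
   therefore keep, by compactness, the invariant that a point of B^(k-i) meets
   at most i of the functions T (h_s (x) e) at size >= d.  As B^(k) misses Omega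
   this starts with i = 0, and at i = k it bounds |T f| by k |T| |e| + l d, which
   for large l and small d contradicts |f| <= c |T f|. *)

Set Implicit Arguments.
Unset Strict Implicit.
Unset Printing Implicit Defensive.

Import Order.TTheory GRing.Theory Num.Theory.
Import numFieldNormedType.Exports.

Local Open Scope classical_set_scope.
Local Open Scope ring_scope.

(** * Sequences spanning c_0 *)

Lemma closed_norm_le {R : realType} {X : topologicalType} {V : normedModType R}
  (f : X -> V) (c : R) : continuous f -> closed [set x | `|f x| <= c].
Proof.
move=> cf; apply: (@preimage_closed _ _ (fun x => `|f x|) [set r | r <= c]).
  by move=> x _; apply: cvg_norm; exact: cf.
exact: closed_le.
Qed.

Lemma closed_norm_ge {R : realType} {X : topologicalType} {V : normedModType R}
  (f : X -> V) (c : R) : continuous f -> closed [set x | c <= `|f x|].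
Proof.
move=> cf; apply: (@preimage_closed _ _ (fun x => `|f x|) [set r | c <= r]).
  by move=> x _; apply: cvg_norm; exact: cf.
exact: closed_ge.
Qed.

Section BoundedOperators.
Context {R : realType} {V W : normedModType R}.
Implicit Types (S : set V) (T : V -> W).

Lemma lipschitz_within_continuous S T (M : R) :
  (forall u v, S u -> S v -> `|T u - T v| <= M * `|u - v|) ->
  {within S, continuous T}.
Proof.
move=> TM; apply/subspace_continuousP => x Sx; apply/cvgrPdist_lt => e e0.
have N0 : 0 < `|M| + 1 by rewrite ltr_wpDl.
rewrite near_withinE; near=> v => Sv.
apply: le_lt_trans (TM _ _ Sx Sv) _.
have : `|x - v| < e / (`|M| + 1).
  near: v; apply: cvgr_dist_lt; last by rewrite divr_gt0.
  exact: cvg_id.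
rewrite ltr_pdivlMr// mulrC => /(le_lt_trans _); apply.
by rewrite ler_wpM2r// (le_trans (ler_norm M))// lerDl.
Unshelve. all: by end_near. Qed.

Lemma within_continuous_linear_bounded S T :
  submod_closed (mem S) ->
  (forall (k : R) u v, S u -> S v -> T (k *: u + v) = k *: T u + T v) ->
  {within S, continuous T} ->
  exists2 M : R, 0 < M & forall u, S u -> `|T u| <= M * `|u|.
Proof.
move=> [S0 SZD] TL /subspace_continuousP Tc.
have {}S0 : S 0 by move: S0; rewrite inE.
have SZ (k : R) u : S u -> S (k *: u).
  move=> Su; have := SZD k u 0; rewrite !inE addr0; exact.
have T0 : T 0 = 0.
  have := TL 1 0 0 S0 S0; rewrite !scale1r addr0 => /eqP.
  by rewrite -subr_eq subrr eq_sym => /eqP.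
have TZ (k : R) u : S u -> T (k *: u) = k *: T u.
  by move=> Su; have := TL k u 0 Su S0; rewrite !addr0 T0 addr0.
have /cvgrPdist_lt/(_ 1 ltr01) := Tc 0 S0.
rewrite near_withinE => /nbhs_normP[r /= r0 Hr].
(* A nonzero [u] rescaled to norm [r / 2] lies in the ball where [T] has norm below 1, whence the
   factor [2 / r]. *)
exists (2 / r) => [|u Su]; first by rewrite divr_gt0.
have [->|u0] := eqVneq u 0; first by rewrite T0 !normr0 mulr0.
have nu : 0 < `|u| by rewrite normr_gt0.
have [k k0 kE] : exists2 k, 0 < k & k = r / 2 / `|u|.
  by exists (r / 2 / `|u|); rewrite ?divr_gt0.
have := Hr (k *: u); rewrite /from_subspace /ball_/= T0 TZ// !sub0r !normrN.
rewrite !normrZ (gtr0_norm k0) {1}kE divfK ?gt_eqF//.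
move=> /(_ ltac:(rewrite ltr_pdivrMr// ltr_pMr// ltr1n//) (SZ _ _ Su)) /ltW.
by rewrite -ler_pdivlMl// mulr1 kE !invf_div [`|u| * _]mulrC.
Qed.

End BoundedOperators.

Section C0Basis.
Context {R : realType} {E : completeNormedModType R}.
Variables (u : nat -> E) (al be : R).
Hypothesis upper : forall n (b : nat -> R) (t : R),
  (forall k, `|b k| <= t) -> `|\sum_(k < n) b k *: u k| <= t * al.
Hypothesis lower : forall k, be <= `|u k|.
Hypothesis be2 : al < be *+ 2.

Let al0 : 0 <= al.
Proof.
by have := @upper 0%N (fun=> 0) 1; rewrite big_ord0 !normr0 mul1r => /(_ (fun=> ler01)).
Qed.

(** By [upper], a block starting at [n] is at most [al] times any bound for the [|b k|] with
    [k >= n], so the series is Cauchy. *)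
Lemma c0_series_cvg (b : nat -> R) : b @ \oo --> (0 : R) ->
  cvgn (series (fun k => b k *: u k)).
Proof.
move=> b0; apply: cauchy_cvg; apply/cauchy_seriesP => e e0.
have A0 : 0 < al + 1 by rewrite ltr_wpDl.
have /cvgrPdist_lt/(_ (e / (al + 1))) := b0.
rewrite divr_gt0// => /(_ isT) [N _ HN].
exists ([set n | (N <= n)%N], [set n | (N <= n)%N]).
  by split; exists N.
move=> [n m] [/= Nn Nm].
rewrite big_geq_mkord big_mkcond/=.
rewrite (eq_bigr (fun k : 'I_m => (if (n <= k)%N then b k else 0) *: u k)); last first.
  by move=> k _; case: ifP; rewrite ?scale0r.
apply: (@le_lt_trans _ _ (e / (al + 1) * al)).
  apply: (@upper m (fun k => if (n <= k)%N then b k else 0) (e / (al + 1))) => k; case: ifPn => nk; last first.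
    by rewrite normr0 divr_ge0// ltW.
  have := HN k (leq_trans Nn nk); rewrite sub0r normrN; exact: ltW.
by rewrite mulrAC ltr_pdivrMr// ltr_pM2l// ltrDl.
Qed.

(* Flipping all signs but the [j]-th and adding leaves [2 b_j u_j]. *)
Lemma c0_series_lower n (b : nat -> R) t j : (forall k, `|b k| <= t) ->
  (j < n)%N -> be *+ 2 * `|b j| - t * al <= `|\sum_(k < n) b k *: u k|.
Proof.
move=> bt jn.
pose b' k := if k == j then b j else - b k.
have E2 : \sum_(k < n) b k *: u k + \sum_(k < n) b' k *: u k = (2 * b j) *: u j.
  rewrite -big_split/= (bigD1 (Ordinal jn))//= big1 ?addr0.
    by rewrite /b' eqxx -scalerDl; congr (_ *: _); ring.
  move=> i ij; rewrite /b' ifF; first by rewrite -scalerDl subrr scale0r.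
  by apply: contra_neqF ij => /eqP ij; apply/val_inj.
have b't k : `|b' k| <= t.
  by rewrite /b'; case: ifP => _; rewrite ?normrN.
have := upper n b't; have := ler_normD (\sum_(k < n) b k *: u k) (\sum_(k < n) b' k *: u k).
rewrite E2 normrZ normrM ger0_norm//.
have : 2 * `|b j| * be <= 2 * `|b j| * `|u j| by rewrite ler_wpM2l// mulr_ge0.
move: (\sum_(k < n) _) (\sum_(k < n) _) => x y; rewrite mulr2n; lra.
Qed.

(** Summing against [u] is bounded above by [al] and, by [c0_series_lower] taken over all
    coordinates, below by [2 be - al > 0], so it maps c_0 isomorphically onto its range. *)
Lemma c0_basis_embedding : contains_c0 E.
Proof.
have be20 : 0 < be *+ 2 := le_lt_trans al0 be2.
pose T (b : bcfun nat R^o) : E := limn (series (fun k => b k *: u k)).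
have Tcvg b : c0 b -> series (fun k => b k *: u k) @ \oo --> T b.
  exact: c0_series_cvg.
have TL (k : R) b c : c0 b -> c0 c -> T (k *: b + c) = k *: T b + T c.
  move=> b0 c0; apply: cvg_lim => //.
  have -> : series (fun i => (k *: b + c) i *: u i) =
     (fun n => k *: series (fun i => b i *: u i) n + series (fun i => c i *: u i) n).
    apply/funext => n; rewrite /series/= scaler_sumr -big_split/=.
    by apply: eq_bigr => i _; rewrite scalerDl scalerA.
  by apply: cvgD; [apply: cvgZl_tmp|]; exact: Tcvg.
have c0s : submod_closed (mem (@c0 R)).
  split; first by rewrite inE; exact: cvg_cst.
  move=> k b c; rewrite !inE => b0 c0; 
  suff : (fun n => k *: (b n : R^o) + (c n : R^o)) @ \oo --> (k *: (0 : R^o) + (0 : R^o)).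
    by rewrite scaler0 addr0.
  by apply: cvgD => //; exact: cvgZl_tmp.
have c0Z k b : c0 b -> c0 (k *: b : bcfun nat R^o).
  move=> b0; rewrite -[k *: b]addr0; move: c0s => [z /(_ k b 0)]; rewrite !inE; apply => //.
  by rewrite inE in z.
have c0B b c : c0 b -> c0 c -> c0 (b - c : bcfun nat R^o).
  move=> b0 c0; rewrite addrC -scaleN1r; move: c0s => [z /(_ (-1) c b)]; rewrite !inE; exact.
have TB b c : c0 b -> c0 c -> T (b - c) = T b - T c.
  by move=> b0 c0; rewrite addrC -scaleN1r TL// scaleN1r addrC.
have Tub b : c0 b -> `|T b| <= al * `|b|.
  move=> b0; apply: (closed_cvg (fun x : E => `|x| <= al * `|b|)) (Tcvg _ b0).
    by apply: closed_norm_le => x; exact: cvg_id.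
  near=> n; rewrite /series/= big_mkord mulrC; apply: upper => k.
  exact: supnorm_ub.
have Tlb b : c0 b -> (be *+ 2 - al) * `|b| <= `|T b|.
  move=> b0; rewrite mulrBl [al * _]mulrC lerBlDr -ler_pdivlMl ?be20//.
  apply: supnorm_le => [|j].
    by rewrite mulr_ge0 ?invr_ge0 ?(ltW be20)// addr_ge0// mulr_ge0.
  rewrite ler_pdivlMl// -lerBlDr.
  apply: (closed_cvg (fun x : E => be *+ 2 * `|b j| - `|b| * al <= `|x|)) (Tcvg _ b0).
    by apply: closed_norm_ge => x; exact: cvg_id.
  near=> n; rewrite /series/= big_mkord; apply: c0_series_lower => [k|].
    exact: supnorm_ub.
  by near: n; exact: nbhs_infty_gt.
have C0 : 0 < be *+ 2 - al by rewrite subr_gt0.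
have Tinj b c : c0 b -> c0 c -> T b = T c -> b = c.
  move=> b0 c0 Tbc; apply/eqP; rewrite -subr_eq0 -normr_eq0 eq_le normr_ge0 andbT.
  have := Tlb _ (c0B _ _ b0 c0); rewrite TB// Tbc subrr normr0.
  by rewrite pmulr_rle0.
pose T' w := if pselect (exists2 b, c0 b & T b = w) is left ex
  then projT1 (cid2 ex) else 0.
have T'K b : c0 b -> T' (T b) = b.
  move=> b0; rewrite /T'; case: pselect => [ex|]; last by case; exists b.
  by case: cid2 => c /= c0 Tc; exact: Tinj.
exists (T @` c0); split => //.
  split; first rewrite inE.
    have c00 : c0 (0 : bcfun nat R^o) by move: c0s => [+ _]; rewrite inE.
    by exists 0 => //; rewrite -[in LHS](subrr 0) TB// subrr.
  move=> k x y; rewrite !inE => -[b b0 <-] [c c0 <-].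
  exists (k *: b + c); last exact: TL.
  by move: c0s => [_ /(_ k b c)]; rewrite !inE; exact.
exists T, T'; split => //.
- by split=> [b b0|_ [b b0 <-]]; [exists b | rewrite T'K].
- split=> [b|w]; rewrite inE; first exact: T'K.
  by move=> [b b0 <-]; rewrite T'K.
- apply: (@lipschitz_within_continuous _ _ _ _ _ al) => b c b0 c0.
  by rewrite -TB//; apply/Tub/c0B.
- apply: (@lipschitz_within_continuous _ _ _ _ _ (be *+ 2 - al)^-1).
  move=> _ _ [b b0 <-] [c c0 <-]; rewrite !T'K// -TB// ler_pdivlMl//.
  exact/Tlb/c0B.
Unshelve. all: by end_near. Qed.

End C0Basis.

(* The suprema [s n] of the tail sums of [z] all lie above [S > 0] and some
   [s N] is below [11/10 S].  Consecutive blocks past [N] of norm at least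
   [9/10 S] therefore form a basic sequence equivalent to the basis of c_0. *)
Lemma contains_c0_of_wuc {R : realType} {E : completeNormedModType R}
    (z : nat -> E) (C : R) :
  (forall n (a : nat -> R), (forall k, `|a k| <= 1) ->
     `|\sum_(k < n) a k *: z k| <= C) ->
  ~ (z @ \oo --> (0 : E)) -> contains_c0 E.
Proof.
move=> zC znot0.
have [d d0 zd] : exists2 d : R, 0 < d & forall n, exists2 j, (n <= j)%N & d <= `|z j|.
  apply: contrapT => nd; apply: znot0; apply/cvgrPdist_lt => e e0.
  apply: contrapT => ne; apply: nd; exists e => // n.
  apply: contrapT => nj; apply: ne; exists n => // j /= nlej.
  by rewrite sub0r normrN ltNge; apply/negP => ej; apply: nj; exists j.
pose P n m (a : nat -> R) := `|\sum_(n <= k < m) a k *: z k|.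
pose Q n : set R := [set r | exists m (a : nat -> R), (forall k, `|a k| <= 1) /\ r = P n m a].
have QC n : ubound (Q n) C.
  move=> _ [m [a [a1 ->]]]; rewrite /P big_geq_mkord big_mkcond/=.
  rewrite (eq_bigr (fun k : 'I_m => (if (n <= k)%N then a k else 0) *: z k)); last first.
    by move=> k _; case: ifP; rewrite ?scale0r.
  apply: (zC _ (fun k => if (n <= k)%N then a k else 0)) => k.
  by case: ifP; rewrite ?normr0.
pose s n := sup (Q n).
have sub n m a : (forall k, `|a k| <= 1) -> P n m a <= s n.
  move=> a1; apply: ub_le_sup; last by exists m, a.
  by exists C; exact: QC.
have ds n : d <= s n.
  have [j nj dz] := zd n; apply: le_trans dz _.
  have := sub n j.+1 (fun k => (k == j)%:R); rewrite /P big_nat_recr//= eqxx scale1r.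
  rewrite big1_seq ?add0r; first by apply=> k; case: (k == j); rewrite ?normr1 ?normr0.
  by move=> k /=; rewrite mem_index_iota => /andP[_ kj]; rewrite ltn_eqF ?scale0r.
pose S := inf (range s).
have Sle n : S <= s n by apply: ge_inf; [exists d => _ [k _ <-]|exists n].
have dS : d <= S by apply: lb_le_inf; [exists (s 0%N), 0%N | move=> _ [k _ <-]].
have S0 : 0 < S by apply: lt_le_trans dS.
have [N sN] : exists N, s N < 11 / 10 * S.
  have [||_ [N _ <-] sN] := @inf_lt _ (range s) (11 / 10 * S); first by exists (s 0%N), 0%N.
    by rewrite ltr_pMl//; lra.
  by exists N.
have /choice[f fP] n : exists ma : nat * (nat -> R),
    (forall k, `|ma.2 k| <= 1) /\ 9 / 10 * S < P n ma.1 ma.2.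
  have [||_ [m [a [a1 ->]]] Pgt] := @sup_gt _ (Q n) (9 / 10 * S).
  - exists (P n 0%N (fun=> 0)), 0%N, (fun=> 0); split=> // k; by rewrite normr0.
  - by apply: (lt_le_trans _ (Sle n)); rewrite gtr_pMl//; lra.
  - by exists (m, a).
pose q n := (f n).1; pose c n := (f n).2.
pose p := fix p k := if k is k'.+1 then q (p k') else N.
(* An empty block has norm 0, which does not exceed [9 / 10 * S]. *)
have qn n : (n < q n)%N.
  have [_] := fP n; rewrite /P ltnNge; apply: contraPN => qn.
  by rewrite big_geq// normr0 ltNge mulr_ge0// ltW.
pose u k := \sum_(p k <= i < p k.+1) c (p k) i *: z i.
have Np n : (N <= p n)%N by elim: n => //= n /leq_trans; apply; exact/ltnW/qn.
(* Coefficients bounded by 1 on the blocks expand to coefficients bounded by 1 on a stretch starting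
   at [N], so [s N] bounds all such combinations. *)
have blocks n (b : nat -> R) : (forall k, `|b k| <= 1) -> exists a : nat -> R,
    (forall k, `|a k| <= 1) /\ \sum_(k < n) b k *: u k = \sum_(N <= i < p n) a i *: z i.
  move=> b1; elim: n => [|n [a [a1 IH]]].
    by exists (fun=> 0); split=> [k|]; rewrite ?normr0// big_ord0 big_geq.
  exists (fun i => if (i < p n)%N then a i else b n * c (p n) i); split=> [k|].
    by case: ifP => // _; rewrite normrM mulr_ile1//; exact: (fP _).1.
  rewrite big_ord_recr/= IH (big_cat_nat (Np n) (ltnW (qn _)))/=; congr (_ + _).
    by apply: eq_big_nat => i /andP[_ ->].
  rewrite scaler_sumr; apply: eq_big_nat => i /andP[pi _].
  by rewrite ltnNge pi/= scalerA.
(* The criterion applies because [11 / 10 < 2 * (9 / 10)]. *)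
apply: (@c0_basis_embedding _ _ u (11 / 10 * S) (9 / 10 * S)).
- move=> n b t bt.
  have [t0|t0] := leP t 0.
    have b0 k : b k = 0.
      by apply/eqP; rewrite -normr_le0; exact: le_trans t0.
    have -> : t = 0 by apply/eqP; rewrite eq_le t0 (le_trans _ (bt 0%N)).
    by rewrite mul0r big1 ?normr0// => k _; rewrite b0 scale0r.
  have [k|a [a1 /(congr1 (fun x => `|t *: x|))]] := blocks n (fun k => t^-1 * b k).
    by rewrite normrM gtr0_norm ?invr_gt0// mulrC ler_pdivrMr// mul1r.
  rewrite scaler_sumr (eq_bigr (fun k : 'I_n => b k *: u k)); last first.
    by move=> k _; rewrite scalerA mulrA divff ?mul1r// gt_eqF.
  move=> ->; rewrite normrZ (gtr0_norm t0) ler_wpM2l ?(ltW t0)//.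
  exact: le_trans (sub N _ _ a1) (ltW sN).
- by move=> k; apply/ltW; exact: (fP (p k)).2.
- by rewrite mulr2n; lra.
Qed.

(** * The Choquet boundary is norming *)

(** Were each sign to fail at some index, both would fail at the smaller of the two, since the order
    of the indices is common to both signs. For a sign that never fails, compactness gives the
    common point. *)
Lemma compact_chain_bool {K : topologicalType} {I : Type} (i0 : I)
    (C : I -> bool -> set K) :
  compact [set: K] -> (forall i s, closed (C i s)) ->
  (forall i j, (forall s, C i s `<=` C j s) \/ (forall s, C j s `<=` C i s)) ->
  (forall i, exists s x, C i s x) ->
  exists s x, forall i, C i s x.
Proof.
move=> cK Ccl Ctot Cne.
have [s sP] : exists s, forall i, C i s !=set0.
  apply: contrapT => ns.
  have [i ni] : exists i, ~ (C i true !=set0).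
    by apply/existsNP => h; apply: ns; exists true.
  apply: ns; exists false => j.
  have [k [ki kj]] : exists k, (forall s, C k s `<=` C i s) /\ (forall s, C k s `<=` C j s).
    by have [ij|ji] := Ctot i j; [exists i|exists j]; split=> // s; exact: subset_refl.
  have [[] [x kx]] := Cne k; last by exists x; apply: kj.
  by exfalso; apply: ni; exists x; apply: ki.
pose F := filter_from [set: I] (fun i => C i s).
have FF : ProperFilter F.
  apply: filter_from_proper => [|i _]; last exact: sP.
  apply: filter_from_filter; first by exists i0.
  move=> i j _ _; have [ij|ji] := Ctot i j.
    by exists i => // x xi; split=> //; apply: ij.
  by exists j => // x xj; split=> //; apply: ji.
have [|x [_ xF]] := cK F FF; first exact: filterT.
exists s, x => i; apply: Ccl => U xU; apply: xF => //.
by exists i.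
Qed.

Section ChoquetBoundary.
Context {R : realType} {K : topologicalType}.
Hypothesis cK : compact [set: K].
Context (A : set (bcfun K R^o)).
Hypothesis As : submod_closed (mem A).
Implicit Types phi : A -> R^o.

(** With a sign available, the norm of each function on a nonempty [K] is the value of some
    [sev s x], so the whole dual ball is [good]. *)
Let sev (s : bool) (x : K) : A -> R^o := fun h => (-1) ^+ s * (set_val h x : R).

Let bc_cont (b : bcfun K R^o) : continuous (b : K -> R^o).
Proof. by have := bcfun_valP b; rewrite inE => -[]. Qed.

Let sev_cont s (b : A) : continuous (fun x => sev s x b : R).
Proof. by move=> x; apply: cvgM; [exact: cvg_cst|exact: bc_cont]. Qed.

Let sev_closed_ge s (b : A) (c : R) : closed [set x | c <= (sev s x b : R)].
Proof.
apply: (@preimage_closed _ _ (fun x => sev s x b : R) [set r | c <= r]).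
  by move=> x _; exact: sev_cont.
exact: closed_ge.
Qed.

Let sev_dual s x : dual_ball A (sev s x).
Proof.
split=> [k a b c E|a]; rewrite /sev ?E/=.
  by rewrite -[X in _ * X]/(k * (set_val a x : R) + (set_val b x : R)) mulrDr mulrCA.
by rewrite normrM normrX normrN1 expr1n mul1r; exact: supnorm_ub.
Qed.

(* Faces of the dual ball on which every [b] in [A] attains its supremum at a
   signed point evaluation; unlike for general faces, this property is inherited
   by the subface where some [a] is maximal and by intersections of chains. *)
Let good (F : set (A -> R^o)) := [/\ F `<=` dual_ball A,
  forall phi psi chi (t : R), F phi -> dual_ball A psi -> dual_ball A chi ->
    0 < t < 1 -> phi = t *: psi + (1 - t) *: chi -> F psi /\ F chi,
  forall s, closed [set x | F (sev s x)] &
  forall b, exists s x, F (sev s x) /\ forall phi, F phi -> phi b <= sev s x b].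

Let good_nonempty F : good F -> exists s x, F (sev s x).
Proof.
move=> [_ _ _ Fb].
have A0 : 0 \in A by have [] := As.
by have [s [x [Fsx _]]] := Fb (SigSub A0); exists s, x.
Qed.

(** On a minimal good face this makes every [a] constant. Extremality survives because a proper
    convex combination of values at most [m] reaches [m] only if both do. *)
Let good_subface F (a : A) (m : R) s0 x0 : good F -> F (sev s0 x0) ->
  sev s0 x0 a = m -> (forall phi, F phi -> phi a <= m) ->
  good (F `&` [set phi | m <= phi a]).
Proof.
move=> [FB Fext Fcl Fb] Fx0 x0m Fm; split.
- by move=> phi [/FB].
- move=> phi psi chi t [Fphi mphi] Bpsi Bchi t01 E.
  have [Fpsi Fchi] := Fext _ _ _ _ Fphi Bpsi Bchi t01 E.
  have := Fm _ Fpsi; have := Fm _ Fchi; move: mphi; rewrite E /= => mphi cm pm.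
  have {mphi}: m <= t * psi a + (1 - t) * chi a := mphi.
  move: t01 => /andP[t0 t1] mphi.
  by split; split=> //=; nra.
- by move=> s; apply: (@closedI _ [set x | F (sev s x)] [set x | m <= sev s x a]).
- (* Points where [b + n a] is maximal on [F], accumulating as [n] grows. *)
  move=> b; pose C n s := [set x | F (sev s x)] `&`
    [set x | forall phi, F phi /\ m <= phi a -> phi b <= sev s x b] `&`
    [set x | n%:R * (m - sev s x a) <= 2 * `|set_val b|].
  have [| | |s [x xC]] := @compact_chain_bool K nat 0%N C cK.
  + move=> n s; apply: closedI; first apply: closedI => //.
      have -> : [set x | forall phi, F phi /\ m <= phi a -> phi b <= sev s x b] =
        \bigcap_(phi in [set phi | F phi /\ m <= phi a]) [set x | phi b <= sev s x b].
        by apply/seteqP; split=> x /= h; exact: h.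
      apply: closed_bigI => phi _.
      exact: sev_closed_ge.
    apply: (@preimage_closed _ _ (fun x => n%:R * (m - sev s x a) : R) [set r | r <= 2 * `|set_val b|]); last exact: closed_le.
    move=> x _; apply: cvgM; first exact: cvg_cst.
    apply: cvgB; [exact: cvg_cst|exact: sev_cont].
  + move=> i j; have [ij|/ltnW ji] := leqP i j; [right|left] => s x [[Fx h] h2]; split=> //=; apply: le_trans h2.
      by rewrite ler_wpM2r ?ler_nat// subr_ge0 Fm.
    by rewrite ler_wpM2r ?ler_nat// subr_ge0 Fm.
  + move=> n.
    have cA : n%:R *: set_val a + set_val b \in A.
      by have [_] := As; apply; exact: valP.
    pose c : A := SigSub cA.
    have cE phi : F phi -> phi c = n%:R * phi a + phi b.
      by move=> /FB[+ _]; apply.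
    have [s [x [Fx xc]]] := Fb c; exists s, x.
    have ax := Fm _ Fx; split=> [|/=]; first split=> // phi [Fphi mphi].
      have := xc _ Fphi; rewrite !cE//.
      have : n%:R * (sev s x a : R) <= n%:R * phi a by rewrite ler_wpM2l// (le_trans ax).
      lra.
    (* Comparison with [x0] bounds [n (m - a)] at [x] by a difference of two values of [b], hence by
       twice its norm. *)
    have := xc _ Fx0; rewrite !cE// x0m.
    have [_ /(_ b)] := sev_dual s x; have [_ /(_ b)] := sev_dual s0 x0.
    rewrite !ler_norml; lra.
  exists s, x; have [[Fx xb] _] := xC 0%N; split; last first.
    by move=> phi [Fphi mphi]; exact: xb.
  (* A bound on [n d] uniform in [n] rules out [d > 0]. *)
  split=> //=; rewrite -subr_le0 leNgt; apply/negP => d0.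
  set d := m - sev s x a in d0 *.
  have q0 : 0 <= (2 * `|set_val b| + 1) / d.
    by rewrite divr_ge0 ?(ltW d0)// addr_ge0// mulr_ge0.
  have := archi_boundP q0; set n := Num.bound _.
  rewrite ltr_pdivrMr//.
  have [_ /= ] := xC n; rewrite -/d; lra.
Qed.

Let good_dual_ball : K -> good (dual_ball A).
Proof.
move=> k0; split=> //.
- move=> s; rewrite (_ : mkset _ = setT); first exact: closedT.
  by apply/seteqP; split=> x //= _; exact: sev_dual.
- move=> b.
  have [||x _ xmax] := @compact_EVT_max K R (fun x => `|set_val b x|) setT _ cK.
  + by exists k0.
  + by apply: continuous_subspaceT => x; apply: cvg_norm; exact: bc_cont.
  exists ((set_val b x : R) < 0), x; split; first exact: sev_dual.
  move=> phi [_ /(_ b) phib]; rewrite /sev -normrEsign.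
  apply: le_trans (ler_norm _) (le_trans phib _).
  by apply: supnorm_le => // y; apply: xmax; rewrite inE.
Qed.

(** Zorn's lemma yields a minimal good face inside the face where [g] is largest. By [good_subface]
    it consists of one signed evaluation, which is then extreme, and removing the sign preserves
    this. *)
Lemma choquet_point_max (g : A) : K ->
  exists2 x, extreme_point (dual_ball A) (fun h : A => set_val h x) &
    forall y, `|set_val g y| <= `|set_val g x|.
Proof.
move=> k0.
have gB := good_dual_ball k0.
have [_ _ _ /(_ g)[s0 [x0 [_ gmax]]]] := gB.
pose m := sev s0 x0 g.
pose F0 := dual_ball A `&` [set phi | m <= phi g].
have gF0 : good F0 by apply: (@good_subface _ g m s0 x0).
pose T := {F | good F /\ F `<=` F0}.
have t0 : T := exist _ F0 (conj gF0 (@subset_refl _ F0)).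
(* The order is reversed, so that a maximal element is a minimal face. *)
pose rel (F G : T) := `[< sval G `<=` sval F >].
have [||C Ctot|[F [gF FF0]] Fmin] := @ZL_preorder T t0 rel.
- by move=> F; apply/asboolP; exact: subset_refl.
- move=> F G H /asboolP FG /asboolP GH; apply/asboolP.
  exact: (subset_trans GH FG).
- have [C0|/existsNP[F1 /contrapT CF1]] := pselect (forall F, ~ C F).
    by exists t0 => F /C0.
  pose I := \bigcap_(F in C) sval F.
  have IF1 : I `<=` sval F1 by move=> phi; apply.
  have gI : good I.
    have gC (F : T) : good (sval F) by case: (svalP F).
    split.
    + by move=> phi /IF1; have [+ _ _ _] := gC F1; apply.
    + move=> phi psi chi t Iphi Bpsi Bchi t01 E; split=> F CF;
      have [_ Fe _ _] := gC F; have [] := Fe _ _ _ _ (Iphi _ CF) Bpsi Bchi t01 E => //.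
    + move=> s; rewrite (_ : mkset _ = \bigcap_(F in C) [set x | sval F (sev s x)]).
        by apply: closed_bigI => F CF; have [_ _ + _] := gC F; apply.
      by apply/seteqP; split.
    (* Each member of the chain has a maximizer of [b], which dominates [b] on the intersection;
       compactness finds one point that serves all members. *)
    + move=> b; pose CC (F : {F | C F}) s := [set x | sval (sval F) (sev s x)] `&`
        [set x | forall phi, I phi -> phi b <= sev s x b].
      have [| | |s [x xC]] := @compact_chain_bool K {F | C F} (exist _ F1 CF1) CC cK.
      * move=> [F CF] s; apply: closedI.
          by have [_ _ + _] := gC F; apply.
        have -> : [set x | forall phi, I phi -> phi b <= sev s x b] =
          \bigcap_(phi in I) [set x | phi b <= sev s x b].
          by apply/seteqP; split=> x /= h; exact: h.
        by apply: closed_bigI => phi _; exact: sev_closed_ge.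
      * move=> [F CF] [G CG]; have [/asboolP GF|/asboolP FG] := Ctot _ _ CF CG; [right|left];
          by move=> s x [/= h1 h2]; split=> //=; auto.
      * move=> [F CF]; have [_ _ _ /(_ b)[s [x [Fx xb]]]] := gC F.
        by exists s, x; split=> //= phi Iphi; apply/xb/Iphi.
      exists s, x; split; last by have [_] := xC (exist _ F1 CF1).
      by move=> F CF; have [] := xC (exist _ F CF).
  have IF0 : I `<=` F0 by move=> phi /IF1; have [_] := svalP F1; apply.
  exists (exist _ I (conj gI IF0)) => F CF; apply/asboolP => phi; exact.
have [s [x Fx]] := good_nonempty gF.
(* By minimality [F] equals its subface where [a] is maximal. *)
have F1 phi a : F phi -> phi a = sev s x a.
  move=> Fphi; have [_ _ _ /(_ a)[s1 [x1 [Fx1 amax]]]] := gF.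
  pose F' := F `&` [set phi | sev s1 x1 a <= phi a].
  have F'F0 : F' `<=` F0 by move=> ? [] /FF0.
  have gF' : good F' by exact: (@good_subface _ a _ s1 x1).
  have /asboolP FF' : rel (exist _ F' (conj gF' F'F0)) (exist _ F (conj gF FF0)).
    by apply: Fmin; apply/asboolP => ? [].
  have aE psi : F psi -> psi a = sev s1 x1 a.
    by move=> Fpsi; apply/le_anti/andP; split; [exact: amax|have [_] := FF' _ Fpsi].
  by rewrite !aE.
exists x; last first.
  move=> y; have [_ /= mx] := FF0 _ Fx.
  have := gmax (sev ((set_val g y : R) < 0) y) (sev_dual _ _).
  rewrite /sev -normrEsign => /le_trans; apply; apply: (le_trans mx).
  by rewrite /sev (le_trans (ler_norm _))// normrM normrX normrN1 expr1n mul1r.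
have ev_dual : dual_ball A (fun h : A => set_val h x).
  suff -> : (fun h : A => set_val h x) = sev false x by exact: sev_dual.
  by apply/funext => h; rewrite /sev expr0 mul1r.
split => // psi chi t Bpsi Bchi t01 E.
(* Multiplied by [(-1) ^+ s], a decomposition of the evaluation becomes one of [sev s x], to which
   the extremality of [F] applies. *)
have signB phi : dual_ball A phi -> dual_ball A ((-1) ^+ s *: phi).
  move=> [phiL phi1]; split=> [k a b c /phiL abc|a].
    by rewrite /= !fctE abc scalerDr !scalerA mulrC.
  by rewrite /= normrZ normrX normrN1 expr1n mul1r.
have [_ Fe _ _] := gF.
have [] := Fe _ _ _ _ Fx (signB _ Bpsi) (signB _ Bchi) t01.
  apply/funext => h; have := congr1 (fun f => (-1) ^+ s * f h) E.
  rewrite /sev => ->; rewrite !fctE mulrDr; congr (_ + _); exact: mulrCA.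
have sK phi : F ((-1) ^+ s *: phi) -> phi = fun h : A => set_val h x.
  move=> Fphi; apply/funext => h; have := F1 _ h Fphi.
  by rewrite /sev /= => /(congr1 (fun r => (-1) ^+ s * r)); rewrite !signrMK.
by move=> /sK + /sK.
Qed.

End ChoquetBoundary.

(** * Sequences of weak peak functions *)

Section LinearSpans.
Context {R : realType} {V : normedModType R}.
Implicit Types S G : set V.

Lemma lin_span_submod_closed G : submod_closed (mem (lin_span G)).
Proof.
split; first by rewrite inE; exists 0%N, (fun=> 0), (fun=> 0); split=> [[]|]//; rewrite big_ord0.
move=> k u v; rewrite !inE => -[n [a [g [gG ->]]]] [m [b [h [hG ->]]]].
exists (n + m)%N, (fun i => match fintype.split i with inl i => k * a i | inr i => b i end),
  (fun i => match fintype.split i with inl i => g i | inr i => h i end).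
split=> [i|]; first by case: fintype.split.
rewrite big_split_ord/= scaler_sumr; congr (_ + _); apply: eq_bigr => i _.
  by rewrite (unsplitK (inl i)) scalerA.
by rewrite (unsplitK (inr i)).
Qed.

Lemma closure_submod_closed S :
  submod_closed (mem S) -> submod_closed (mem (closure S)).
Proof.
move=> [S0 SZD]; split; first by move: S0; rewrite !inE; exact: subset_closure.
move=> k u v; rewrite !inE => Su Sv B /nbhs_normP[r /= r0 rB].
(* The summand 1 keeps the radius for [u] meaningful when [k = 0]. *)
have K0 : 0 < 2 * (`|k| + 1) by rewrite mulr_gt0// ltr_wpDl.
have [|u' [Su' uu']] := Su (ball_ Num.norm u (r / (2 * (`|k| + 1)))).
  by apply/nbhs_normP; exists (r / (2 * (`|k| + 1))) => //=; rewrite divr_gt0.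
have [|v' [Sv' vv']] := Sv (ball_ Num.norm v (r / 2)).
  by apply/nbhs_normP; exists (r / 2) => //=; rewrite divr_gt0.
exists (k *: u' + v'); split; first by have := SZD k u' v'; rewrite !inE; exact.
apply: rB; rewrite /ball_/= opprD addrACA -scalerBr (le_lt_trans (ler_normD _ _))//.
rewrite normrZ [ltRHS]splitr ler_ltD//.
move: uu'; rewrite /ball_/= ltr_pdivlMr//.
have := normr_ge0 k; have := normr_ge0 (u - u').
move: `|u - u'| `|k| => x y; nra.
Qed.

End LinearSpans.

Lemma canonical_scalar_space_submod_closed {R : realType} {K : topologicalType}
  {E : normedModType R} (H : set (bcfun K E)) :
  submod_closed (mem (canonical_scalar_space H)).
Proof. exact/closure_submod_closed/lin_span_submod_closed. Qed.

(** Choose a point of [S] other than [x] in the current neighbourhood of [x] and separate the two by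
    disjoint open sets; the part around [x] is the next neighbourhood. All later choices lie in it,
    hence miss the set chosen now. *)
Lemma limit_point_separated_sequence {X : topologicalType} (S U : set X) x :
  hausdorff_space X -> limit_point S x -> nbhs x U ->
  exists (xs : nat -> X) (W : nat -> set X),
    (forall n, [/\ S (xs n), U (xs n) & nbhs (xs n) (W n)]) /\
    forall i j y, W i y -> W j y -> i = j.
Proof.
move=> hX Sx xU.
pose T := {V : set X | open_nbhs x V /\ V `<=` U}.
have t0 : T.
  exists (interior U); split; last exact: interior_subset.
  by split; [exact: open_interior|].
(* The triple packs the point, its open neighbourhood and the next neighbourhood of [x]. *)
have /choice[f fP] (V : T) : exists d : X * set X * T,
    [/\ S d.1.1, sval V d.1.1, open_nbhs d.1.1 d.1.2 & 
     [/\ d.1.2 `<=` sval V, sval d.2 `<=` sval V & d.1.2 `&` sval d.2 = set0]].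
  case: V => V [[oV Vx] VU] /=.
  have [y [yx Sy Vy]] : exists y, [/\ y != x, S y & V y].
    by apply: Sx; apply: open_nbhs_nbhs.
  move: hX; rewrite open_hausdorff => /(_ _ _ yx)[[P Q]/= [Py Qx] [oP oQ PQ]].
  move: Py Qx; rewrite !inE => Py Qx.
  have VQ : open_nbhs x (V `&` Q) /\ V `&` Q `<=` U.
    by split; [split => //; exact: openI | move=> z [/VU]].
  exists (y, V `&` P, exist (fun V => open_nbhs x V /\ V `<=` U) _ VQ); split=> //=.
    by split => //; exact: openI.
  split; [by move=> ? []|by move=> ? []|].
  by rewrite setIACA (eqP PQ) setI0.
pose v := fix v n : T := if n is n'.+1 then (f (v n')).2 else t0.
exists (fun n => (f (v n)).1.1), (fun n => (f (v n)).1.2); split=> [n|].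
  have [h1 h2 h3 _] := fP (v n); split=> //; last exact: open_nbhs_nbhs.
  by have [_] := svalP (v n); apply.
have vS n m : (n <= m)%N -> sval (v m) `<=` sval (v n).
  elim: m => [|m IH]; first by rewrite leqn0 => /eqP ->.
  rewrite leq_eqVlt => /predU1P[->//|/IH]; apply: subset_trans.
  by have [_ _ _ []] := fP (v m).
have disj i j y : (i < j)%N -> (f (v i)).1.2 y -> ~ (f (v j)).1.2 y.
  move=> ij iy jy; have [_ _ _ [_ _ i0]] := fP (v i).
  have [_ _ _ [jv _ _]] := fP (v j).
  have : ((f (v i)).1.2 `&` sval (f (v i)).2) y.
    by split=> //; apply: (vS _ _ ij); exact: jv.
  by rewrite i0.
move=> i j y iy jy; have [ij|ji|//] := ltngtP i j.
  by have := disj _ _ _ ij iy jy.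
by have := disj _ _ _ ji jy iy.
Qed.

Section PeakSequences.
Context {R : realType} {K : topologicalType} {E : normedModType R}.
Hypotheses (cK : compact [set: K]) (hK : hausdorff_space K).
Context (H : set (bcfun K E)).

Lemma bcfun_sumE {E' : normedModType R} (I : Type) (r : seq I) (f : I -> bcfun K E') x :
  (\sum_(i <- r) f i) x = \sum_(i <- r) f i x.
Proof. by elim/big_ind2 : _ => // ? ? ? ? <- <-. Qed.

(** [choquet_point_max] places a maximum of [|g|] on the Choquet boundary. *)
Lemma le_choquet_boundary (g : bcfun K R^o) (c : R) :
  canonical_scalar_space H g ->
  (forall y, choquet_boundary H y -> `|g y| <= c) -> forall y, `|g y| <= c.
Proof.
move=> Ag gc y.
have [x Cx gx] := choquet_point_max cK (canonical_scalar_space_submod_closed H)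
  (SigSub (mem_set Ag)) y.
exact: le_trans (gx y) (gc _ Cx).
Qed.

(** At a Choquet boundary point, disjointness of the neighbourhoods leaves at most one [h k] that
    need not be below [eps k]; it is at most 1, and the [eps k] sum to less than 1. The resulting
    factor 2 extends to all of [K] by [le_choquet_boundary]. *)
Lemma peak_sequence (S U : set K) x : S `<=` weak_peak_points H ->
  limit_point S x -> nbhs x U ->
  exists (xs : nat -> K) (h : nat -> bcfun K R^o),
    (forall n, [/\ S (xs n), U (xs n), tensor_multipliers H (h n),
      forall y, 0 <= (h n y : R) <= 1 & 2^-1 < (h n (xs n) : R)]) /\
    forall n (a : nat -> R) (e : E), (forall k, `|a k| <= 1) ->
      `|\sum_(k < n) a k *: tensor (h k) e| <= 2 * `|e|.
Proof.
move=> SW Sx xU.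
have [xs [W [xsP Wdisj]]] := limit_point_separated_sequence hK Sx xU.
(* Starting at [1 / 2] also ensures that every peak exceeds one half. *)
pose eps n : R := 2^-1 ^+ n.+1.
have eps01 n : 0 < eps n < 1.
  by rewrite /eps exprn_gt0//= exprn_ilt1// invf_lt1// ltr1n.
have /choice[h hP] n : exists h : bcfun K R^o,
    [/\ tensor_multipliers H h, forall y, 0 <= (h y : R) <= 1,
      1 - eps n < h (xs n) &
      forall y, choquet_boundary H y -> ~ W n y -> (h y : R) < eps n].
  by have [/SW xsW _ Wxs] := xsP n; exact: xsW.
exists xs, h; split=> [n|n a e a1].
  have [xS xxU _] := xsP n; have [hH h01 hx _] := hP n; split=> //.
  apply: le_lt_trans hx; rewrite lerBrDl -lerBrDr.
  apply: (@le_trans _ _ 2^-1); last lra.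
  by rewrite /eps exprS ler_piMr// exprn_ile1// invf_le1// ler1n.
pose g : bcfun K R^o := \sum_(k < n) a k *: h k.
have gE y : g y = \sum_(k < n) a k * (h k y : R) by rewrite bcfun_sumE.
have Ag : canonical_scalar_space H g.
  rewrite /g; elim: (n) => [|m IH].
    by rewrite big_ord0; have [+ _] := canonical_scalar_space_submod_closed H; rewrite inE.
  rewrite big_ord_recr/= addrC; have [_ /(_ (a m) (h m) (\sum_(k < m) a k *: h k))] := canonical_scalar_space_submod_closed H.
  by rewrite !inE; apply => //; have [[]] := hP m.
have g2 : forall y, `|g y| <= 2.
  apply: le_choquet_boundary => // y Cy; rewrite gE.
  have hb k : (h k y : R) <= (`[< W k y >])%:R + eps k.
    have [_ /(_ y)/andP[_ h1] _ hW] := hP k.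
    have /andP[/ltW e0 _] := eps01 k.
    case: asboolP => Wy; last by rewrite add0r; exact/ltW/hW.
    by rewrite (le_trans h1)// lerDl.
  apply: (@le_trans _ _ (\sum_(k < n) ((`[< W k y >])%:R + eps k))).
    apply: le_trans (ler_norm_sum _ _ _) _; apply: ler_sum => k _.
    have [_ /(_ y)/andP[h0 _] _ _] := hP k.
    by apply: le_trans (hb k); rewrite normrM (ger0_norm h0) ler_piMl.
  rewrite big_split/= (_ : 2 = 1 + 1)// lerD//.
    have [[j Wj]|nW] := pselect (exists j : 'I_n, W j y).
      rewrite (bigD1 j)//= big1 ?addr0; first by case: asboolP.
      move=> i ij; case: asboolP => // Wi; exfalso; move/eqP : ij; apply.
      by apply/val_inj; exact: Wdisj Wi Wj.
    by rewrite big1// => i _; case: asboolP => // Wi; exfalso; apply: nW; exists i.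
  have -> : \sum_(k < n) eps k = 1 - 2^-1 ^+ n.
    elim: (n) => [|m IH]; first by rewrite big_ord0 expr0 subrr.
    by rewrite big_ord_recr/= IH /eps !exprS; field.
  by rewrite lerBlDr lerDl exprn_ge0.
apply: supnorm_le => [|y]; first by rewrite mulr_ge0.
rewrite bcfun_sumE (_ : \sum_(i < n) _ = g y *: e).
  by rewrite normrZ ler_wpM2r.
by rewrite gE scaler_suml; apply: eq_bigr => k _; rewrite -scalerA.
Qed.

End PeakSequences.

(** * Derivatives of a closed boundary *)

Section CantorBendixsonCount.
Context {R : realType} {K : topologicalType} {E : normedModType R}.
Hypotheses (cK : compact [set: K]) (hK : hausdorff_space K).
Implicit Types (B : set K) (gs : seq (bcfun K E)).

Lemma closed_cb_deriv B n : closed B -> closed (cb_deriv n B).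
Proof.
move=> cB; elim: n => //= n IH; apply: closedI => //.
exact/limit_point_closed/hausdorff_accessible.
Qed.

Definition large_count (d : R) gs y := count (fun g : bcfun K E => d <= `|g y|) gs.

Lemma closed_large_count d gs i : closed [set y | (i <= large_count d gs y)%N].
Proof.
elim: gs i => [|g gs IH] [|i].
- rewrite (_ : mkset _ = setT); first exact: closedT.
  by apply/seteqP; split.
- rewrite (_ : mkset _ = set0); first exact: closed0.
  by apply/seteqP; split.
- rewrite (_ : mkset _ = setT); first exact: closedT.
  by apply/seteqP; split.
rewrite (_ : mkset _ = [set y | d <= `|g y|] `&` [set y | (i <= large_count d gs y)%N] `|`
   [set y | (i < large_count d gs y)%N]); last first.
  apply/seteqP; split=> y /=; rewrite /large_count/=.
    by case: (d <= `|g y|); rewrite ?add1n ?add0n ?ltnS => ?; [left|right].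
  by move=> [[-> h]|h]; rewrite ?add1n ?ltnS// (leq_trans h)// leq_addl.
apply: closedU => //; apply: closedI => //; apply: closed_norm_ge.
by have := bcfun_valP g; rewrite inE => -[].
Qed.

(** A large term costs at most [M], any other less than [d]; for simplicity [d] is charged to every
    term. *)
Lemma large_count_sum d gs (M : R) y : 0 <= d -> (forall g, g \in gs -> `|g y| <= M) ->
  `|\sum_(g <- gs) g y| <= (large_count d gs y)%:R * M + (size gs)%:R * d.
Proof.
move=> d0; elim: gs => [|g gs IH] gM; first by rewrite big_nil normr0 !mul0r addr0.
rewrite big_cons (le_trans (ler_normD _ _))//.
have {}IH : `|\sum_(g <- gs) g y| <= (large_count d gs y)%:R * M + (size gs)%:R * d.
  by apply: IH => h hs; apply: gM; rewrite inE hs orbT.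
have gyM := gM g (mem_head _ _).
rewrite /large_count/= -/(large_count d gs y) natrD -[in X in _ <= _ + X]natr1.
have [dg|/ltW gd] := leP d `|g y|; rewrite !mulrDl ?mul1r ?mul0r; lra.
Qed.

(** The condition [i <= k] keeps [k - i] from truncating, so [i = 0] concerns the last derivative
    and [i = k] concerns [B] itself. *)
Definition sparse (B : set K) k d gs := forall i y, (i <= k)%N ->
  cb_deriv (k - i) B y -> (large_count d gs y <= i)%N.

(* The points of rank at least [k - i] that already meet [i] large functions
   do not accumulate, so by compactness some term of [g] is small on all of them. *)
Lemma sparse_cons B k d gs (g : nat -> bcfun K E) : closed B -> 0 < d ->
  sparse B k d gs ->
  (forall y, cb_deriv k B y -> forall n, g n y = 0) ->
  (forall y, (fun n => g n y) @ \oo --> (0 : E)) ->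
  exists n, sparse B k d (g n :: gs).
Proof.
move=> cB d0 Hgs gk g0.
pose D i := cb_deriv (k - i) B `&` [set y | (i <= large_count d gs y)%N].
(* A limit point of [D i] lies in the derivative of order [k - i + 1], where at most [i - 1]
   functions are large, while closedness of [D i] demands [i] of them. *)
have Dlim i y : (0 < i <= k)%N -> ~ limit_point (D i) y.
  move=> /andP[i0 ik] yD.
  have iE : (k - i.-1 = (k - i).+1)%N by rewrite -subSn// -subSS prednK.
  have := Hgs i.-1 y (leq_trans (leq_pred i) ik).
  have Dc : closed (D i).
    by apply: closedI; [exact: closed_cb_deriv|exact: closed_large_count].
  have [Dy /= iy] : D i y by apply/Dc/subset_limit_point.
  rewrite iE => h; have : cb_deriv (k - i).+1 B y.
    split=> // U yU; have [z [zy [zD _] Uz]] := yD U yU; by exists z.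
  by move=> /h /(leq_trans iy); rewrite leqNgt prednK ?leqnn.
have near_i (i : 'I_k.+1) : \forall n \near \oo, forall y, (0 < i)%N -> D i y -> `|g n y| < d.
  have := cK; rewrite compact_near_coveringP => /(_ nat \oo (fun n y => (0 < i)%N -> D i y -> `|g n y| < d)) /=.
  move=> h; have {h} : \forall n \near \oo, forall y, [set: K] y -> (0 < i)%N -> D i y -> `|g n y| < d.
    apply: h => y _; have [i0|i0] := posnP i.
      by near=> y' n; rewrite i0.
    have := @Dlim i y; rewrite i0 -ltnS ltn_ord => /(_ isT).
    (* Some neighbourhood [U] of [y] meets [D i] at most in [y], so convergence at the single point
       [y] suffices there. *)
    rewrite not_limit_pointE => -[U yU UD].
    have /cvgrPdist_lt/(_ _ d0) gy := g0 y.
    exists (U, [set n | `|0 - g n y| < d]) => //= -[z n] /= [Uz gz] _ Dz.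
    by rewrite (UD z (conj Dz Uz)) -normrN -sub0r.
  by apply: filterS => n + y; apply.
have [n nP] : exists n, forall (i : 'I_k.+1) y, (0 < i)%N -> D i y -> `|g n y| < d.
  have : \forall n \near \oo, forall (i : 'I_k.+1) y, (0 < i)%N -> D i y -> `|g n y| < d.
    by apply: filter_forall.
  by move=> [n _ nP]; exists n; apply: nP => /=.
exists n => i y ik yi.
have ci := Hgs i y ik yi.
rewrite /large_count/= -/(large_count d gs y).
(* Below [i] there is room for one more large function; otherwise [y] lies in [D i], where [g n] is
   small. *)
have [iy|] := leqP i (large_count d gs y); last first.
  by move=> ?; case: (_ <= _) => //; rewrite add0n.
rewrite leNgt; suff -> : `|g n y| < d by rewrite add0n.
have [i0|i0] := posnP i.
  by rewrite gk ?normr0// -(subn0 k) -i0.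
have ik' : (i < k.+1)%N by rewrite ltnS.
by apply: (nP (Ordinal ik')).
Unshelve. all: by end_near. Qed.

End CantorBendixsonCount.

(** * The embedding argument *)

Lemma cb_deriv_subset {X : topologicalType} (S : set X) n : cb_deriv n S `<=` S.
Proof. by elim: n => //= n IH x [/IH]. Qed.

Lemma near_all_seq {T : Type} (F : set_system T) {FF : Filter F} {I : eqType} (s : seq I)
    (P : I -> T -> Prop) :
  (forall i, i \in s -> \forall x \near F, P i x) ->
  \forall x \near F, forall i, i \in s -> P i x.
Proof.
elim: s => [|j s IH] sP; first by near=> x.
have sF : \forall x \near F, forall i, i \in s -> P i x.
  by apply: IH => i si; apply: sP; rewrite inE si orbT.
have jF : \forall x \near F, P j x by apply: sP; rewrite mem_head.
by apply: filterS2 sF jF => x sx jx i; rewrite inE => /predU1P[->|/sx].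
Unshelve. all: by end_near. Qed.

Section LinearSums.
Context {R : realType} {V W : normedModType R} (S : set V) (T : V -> W).
Hypothesis Ss : submod_closed (mem S).
Hypothesis TL :
  forall (k : R) u v, S u -> S v -> T (k *: u + v) = k *: T u + T v.

Lemma linear_on_sum (I : eqType) (r : seq I) (a : I -> R) (v : I -> V) :
  (forall i, i \in r -> S (v i)) ->
  S (\sum_(i <- r) a i *: v i) /\
  T (\sum_(i <- r) a i *: v i) = \sum_(i <- r) a i *: T (v i).
Proof.
move: Ss => [S0 SZD]; have {}S0 : S 0 by rewrite inE in S0.
elim: r => [|i r IH] Sv.
  rewrite !big_nil; split=> //; have := TL 1 S0 S0.
  by rewrite !scale1r addr0 => /eqP; rewrite -subr_eq subrr eq_sym => /eqP.
have [Sr Tr] : S (\sum_(i <- r) a i *: v i) /\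
    T (\sum_(i <- r) a i *: v i) = \sum_(i <- r) a i *: T (v i).
  by apply: IH => j rj; apply: Sv; rewrite inE rj orbT.
have Si : S (v i) by apply: Sv; rewrite mem_head.
rewrite !big_cons; split; last by rewrite TL// Tr.
by have := SZD (a i) (v i) (\sum_(i <- r) a i *: v i); rewrite !inE; exact.
Qed.

End LinearSums.

Section PeakChains.
Context {R : realType} {K1 K2 : topologicalType}.
Context {E1 : normedModType R} {E2 : completeNormedModType R}.
Context (H1 : set (bcfun K1 E1)) (H2 : set (bcfun K2 E2)) (B : set K2).
Hypotheses (cK1 : compact [set: K1]) (hK1 : hausdorff_space K1).
Hypotheses (cK2 : compact [set: K2]) (hK2 : hausdorff_space K2).
Hypotheses (H1s : submod_closed (mem H1)) (nc0 : ~ contains_c0 E2).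
Hypotheses (cB : closed B) (k : nat) (Bk : cb_deriv k B `&` Omega H2 = set0).
Context (T : bcfun K1 E1 -> bcfun K2 E2) (M : R).
Hypothesis TL :
  forall (a : R) u v, H1 u -> H1 v -> T (a *: u + v) = a *: T u + T v.
Hypothesis TH : forall u, H1 u -> H2 (T u).
Hypothesis TM : forall u, H1 u -> `|T u| <= M * `|u|.
Hypothesis M0 : 0 <= M.

(** Each new function uses up one order of derivative at the base point, which moves only within the
    set where all earlier functions exceed one half. *)
Lemma peak_chain (e : E1) (d : R) l x0 m : 0 < d ->
  cb_deriv l (weak_peak_points H1) x0 -> (m <= l)%N ->
  exists (hs : seq (bcfun K1 R^o)) (x : K1), 
    [/\ size hs = m, cb_deriv (l - m) (weak_peak_points H1) x,
      forall h, h \in hs -> [/\ tensor_multipliers H1 h,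
        forall y, 0 <= (h y : R) <= 1 & 2^-1 < (h x : R)] &
      sparse B k d (map (fun h => T (tensor h e)) hs)].
Proof.
move=> d0 x0l; elim: m => [_|m IH ml].
  exists [::], x0; split=> //; first by rewrite subn0.
have [hs [x [hsm xm hsP hsB]]] := IH (ltnW ml).
(* As [m < l], the order [l - m] is positive and [x] is a limit point of the derivative of order
   [l - m.+1]. *)
move: xm; rewrite -[(l - m)%N]prednK ?subn_gt0// -subnS => -[_ xm].
pose U := [set y | forall h, h \in hs -> 2^-1 < (h y : R)].
have xU : nbhs x U.
  apply: near_all_seq => h hhs; have [_ _ hx] := hsP h hhs.
  have : continuous (h : K1 -> R^o) by have := bcfun_valP h; rewrite inE => -[].
  by move=> /(_ x)/cvgr_gt; apply.
have [xs [h [hP hsum]]] := peak_sequence cK1 hK1 (@cb_deriv_subset _ _ _) xm xU.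
have hH n : H1 (tensor (h n) e) by have [_ _ [_ +] _ _] := hP n; apply.
have [n nB] : exists n, sparse B k d (T (tensor (h n) e) :: map (fun h => T (tensor h e)) hs).
  apply: (sparse_cons cK2 hK2 (g := fun n => T (tensor (h n) e))) => // y.
    move=> yk n; apply: contrapT => /eqP Ty.
    suff : (cb_deriv k B `&` Omega H2) y by rewrite Bk.
    by split=> //; exists (T (tensor (h n) e)) => //; exact: TH.
  (* The bound on signed sums passes through [T] to values at [y]; if these did not tend to 0, [E2]
     would contain c_0. *)
  apply: contrapT => ny; apply: nc0.
  apply: (@contains_c0_of_wuc _ _ (fun n => T (tensor (h n) e) y) (M * (2 * `|e|))) => //.
  move=> n a a1.
  have [Hs Ts] := linear_on_sum H1s TL (r := index_enum 'I_n) (fun i => a (nat_of_ord i))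
    (v := fun i => tensor (h i) e) (fun i _ => hH i).
  have -> : \sum_(i < n) a i *: T (tensor (h i) e) y =
     (T (\sum_(i < n) a i *: tensor (h i) e)) y.
    by rewrite Ts bcfun_sumE.
  apply: le_trans (supnorm_ub _ _) (le_trans (TM Hs) _).
  by rewrite ler_wpM2l// hsum.
exists (h n :: hs), (xs n); have [xsS xsU hn1 hn2 hn3] := hP n; split=> //=.
  by rewrite hsm.
move=> h'; rewrite inE => /predU1P[->//|h'hs].
by have [? ? _] := hsP h' h'hs; split=> //; exact: xsU.
Qed.

End PeakChains.

Theorem corollary1p4 (R : realType) (K1 K2 : topologicalType)
    (E1 E2 : completeNormedModType R)
    (H1 : set (bcfun K1 E1)) (H2 : set (bcfun K2 E2)) (B : set K2) :
  compact [set: K1] -> hausdorff_space K1 ->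
  compact [set: K2] -> hausdorff_space K2 ->
  (exists e : E1, e != 0) -> (exists e : E2, e != 0) ->
  closed_subspace H1 -> (exists2 h, H1 h & h != 0) ->
  closed_subspace H2 -> (exists2 h, H2 h & h != 0) ->
  ~ contains_c0 E2 ->
  closed_boundary H2 B ->
  isomorphic_to_subspace H1 H2 ->
  (exists2 k : nat, (0 < k)%N & cb_deriv k B `&` Omega H2 = set0) ->
  finite_height (weak_peak_points H1).
Proof.
move=> cK1 hK1 cK2 hK2 [e e0] _ [H1s _] _ _ _ nc0 [cB bB].
move=> [L [Ls LH2 [T [T' [TL [TH T'H] [TK T'K] Tc T'c]]]]] [k _ Bk].
have [M M0 TM] := within_continuous_linear_bounded H1s TL Tc.
(* [isomorphic] asks linearity of [T] only, so that of the inverse is derived. *)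
have T'L (a : R) u v : L u -> L v -> T' (a *: u + v) = a *: T' u + T' v.
  move=> Lu Lv.
  have [H1u H1v] := (T'H _ Lu, T'H _ Lv).
  have H1uv : H1 (a *: T' u + T' v).
    by have [_ /(_ a (T' u) (T' v))] := H1s; rewrite !inE; exact.
  by rewrite -[RHS]TK ?inE// TL// !T'K ?inE.
have [c c0 T'M] := within_continuous_linear_bounded Ls T'L T'c.
have Tc' u : H1 u -> `|u| <= c * `|T u|.
  by move=> Hu; rewrite -{1}[u]TK ?inE//; apply/T'M/TH.
apply: contrapT => /forallNP infh.
have ne : 0 < `|e| by rewrite normr_gt0.
(* This makes [c l d] half of the lower bound [l |e| / 2]. What remains is [l / 4 <= c k M], which
   the choice of [l] excludes. *)
pose d := `|e| / (4 * c).
have d0 : 0 < d by rewrite divr_gt0// mulr_gt0.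
have := archi_boundP (x := 4 * c * k%:R * M); rewrite !mulr_ge0// ?(ltW c0) ?(ltW M0)// => /(_ isT).
set l := Num.bound _ => lbig.
have /set0P[x0 x0l] : cb_deriv l (weak_peak_points H1) != set0 by apply/eqP/infh.
have TH2 u : H1 u -> H2 (T u) by move=> /TH /LH2.
have [hs [x [hsl _ hsP hsB]]] := peak_chain cK1 hK1 cK2 hK2 H1s nc0 cB Bk TL TH2
  TM (ltW M0) e d0 x0l (leqnn l).
have hH h : h \in hs -> H1 (tensor h e) by move=> /hsP[[_ +] _ _]; apply.
have [Hs] := linear_on_sum H1s TL (r := hs) (fun=> 1)
  (v := fun h => tensor h e) hH.
rewrite (eq_bigr (fun h => tensor h e)) in Hs *; last by move=> *; rewrite scale1r.
rewrite (eq_bigr (fun h => T (tensor h e))); last by move=> *; rewrite scale1r.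
set f := \sum_(h <- hs) tensor h e in Hs * => Tf.
have lower : l%:R / 2 * `|e| <= `|f|.
  apply: le_trans (supnorm_ub f x); rewrite bcfun_sumE.
  have -> : \sum_(h <- hs) tensor h e x = (\sum_(h <- hs) (h x : R)) *: e.
    by rewrite scaler_suml.
  rewrite normrZ ler_wpM2r// (le_trans _ (ler_norm _))//.
  rewrite -hsl -sum1_size natr_sum mulr_suml big_seq [leRHS]big_seq.
  by apply: ler_sum => h hhs; have [_ _ /ltW] := hsP h hhs; rewrite mul1r.
have upper : `|T f| <= k%:R * (M * `|e|) + l%:R * d.
  have C0 : 0 <= k%:R * (M * `|e|) + l%:R * d.
    by rewrite addr_ge0// mulr_ge0// ?(ltW d0)// mulr_ge0// ltW.
  rewrite (bB _ (TH2 _ Hs)).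
  have [->|/set0P ne0] := eqVneq [set `|T f x| | x in B] set0; first by rewrite sup0.
  apply: ge_sup => // _ [y By <-].
  have := @large_count_sum _ _ _ d (map (fun h => T (tensor h e)) hs) (M * `|e|) y (ltW d0).
  rewrite -bcfun_sumE big_map -Tf size_map hsl => /(_ _)/le_trans; apply.
    move=> _ /mapP[h hhs ->]; have [_ h01 _] := hsP h hhs.
    apply: le_trans (supnorm_ub _ _) (le_trans (TM _ (hH _ hhs)) _).
    rewrite ler_wpM2l ?(ltW M0)//; apply: supnorm_le => // z.
    by rewrite /= normrZ; have /andP[h0 h1] := h01 z; rewrite ger0_norm// ler_piMl.
  rewrite lerD2r ler_wpM2r ?mulr_ge0 ?(ltW M0)// ler_nat.
  (* At [i = k] the invariant covers [cb_deriv 0 B], which is [B]. *)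
  by apply: (hsB k) => //; rewrite subnn.
have : l%:R / 2 * `|e| <= c * (k%:R * (M * `|e|) + l%:R * d).
  by apply: le_trans lower (le_trans (Tc' _ Hs) _); rewrite ler_wpM2l// ltW.
rewrite mulrDr.
have -> : c * (l%:R * d) = l%:R / 4 * `|e|.
  by rewrite /d; field; rewrite gt_eqF.
have -> : c * (k%:R * (M * `|e|)) = (c * k%:R * M) * `|e| by ring.
rewrite -mulrDl ler_pM2r//; lra.
Qed.
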